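(* Let $P$ be any set of $n\geq 3$ points in general position in the plane, and let $D(P)$ be its edge disjointness graph. Then $$\kappa(D(P))\ \geq\ \binom{\lfloor\frac{n-2}{2}\rfloor}{2}+\binom{\lceil\frac{n-2}{2}\rceil}{2}.$$
   Context: A point set in the plane is in general position if no three of its points are collinear. The edge disjointness graph $D(P)$ is the graph whose vertices are all the closed straight line segments $xy$ with distinct endpoints $x,y\in P$; two vertices are adjacent if and only if the corresponding segments are disjoint (as subsets of the plane). A graph $H$ is $k$-connected ($k\ge 0$ an integer) if $|V(H)|>k$ and $H\setminus W$ is connected for every $W\subset V(H)$ with $|W|<k$. The connectivity $\kappa(H)$ is the greatest integer $k$ such that $H$ is $k$-connected, with $\kappa(H)=0$ if and only if $H$ is disconnected or $|V(H)|=1$. By convention $\binom{m}{2}=0$ if $m<2$. *)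

(* Defs.v *)
From mathcomp Require Import all_boot all_order all_algebra finmap.
From mathcomp Require Import boolp classical_sets set_interval reals.

Set Implicit Arguments.
Unset Strict Implicit.
Unset Printing Implicit Defensive.

Import Order.TTheory GRing.Theory Num.Theory.

Local Open Scope classical_set_scope.
Local Open Scope ring_scope.

(* A simple graph is a finite vertex type V with a symmetric irreflexive
   e : rel V. *)

Definition connected_on (V : finType) (e : rel V) (S : {set V}) : bool :=
  [forall x in S, forall y in S, connect [rel u v in S | e u v] x y].

Definition kconnected (V : finType) (e : rel V) (k : nat) : bool :=
  (k < #|V|)%N &&
  [forall W : {set V}, (#|W| < k)%N ==> connected_on e (~: W)%SET].

(* A k-connected graph has more than k vertices, so this maximum ranges over
   all candidates. It is 0 on the empty graph. *)
Definition connectivity (V : finType) (e : rel V) : nat :=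
  (\max_(k < #|V| | kconnected e k) k)%N.

Lemma kconnected_le (V : finType) (e : rel V) (j k : nat) :
  (j <= k)%N -> kconnected e k -> kconnected e j.
Proof.
move=> jk /andP[kV /forallP H]; apply/andP; split; first exact: leq_ltn_trans kV.
by apply/forallP => W; apply/implyP => Wj; apply: (implyP (H W)); apply: leq_trans jk.
Qed.

Lemma connectivityP (V : finType) (e : rel V) (k : nat) :
  (0 < #|V|)%N -> kconnected e k = (k <= connectivity e)%N.
Proof.
move=> V0; apply/idP/idP => [kk | kle].
  have kV : (k < #|V|)%N by case/andP: kk.
  exact: (@leq_bigmax_cond _ (fun i : 'I_#|V| => kconnected e i)
            (fun i : 'I_#|V| => val i) (Ordinal kV)).
apply: kconnected_le kle _; rewrite /connectivity.
have k0 : kconnected e (Ordinal V0).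
  by rewrite /kconnected V0; apply/forallP => W; apply/implyP.
have /= [|i /= ki ->] := @eq_bigmax_cond _
    [pred i : 'I_#|V| | kconnected e i] (fun i => val i).
  by apply/card_gt0P; exists (Ordinal V0).
exact: ki.
Qed.

Lemma connectivity_eq0 (V : finType) (e : rel V) :
  (0 < #|V|)%N ->
  (connectivity e == 0%N) = ~~ connected_on e [set: V]%SET || (#|V| == 1%N).
Proof.
move=> V0; rewrite -leqn0 leqNgt -(connectivityP e 1 V0) /kconnected.
rewrite negb_and orbC -leqNgt; congr (_ || _).
  congr (~~ _); apply/forallP/idP => [/(_ finset.set0)|H W].
    by rewrite cards0 finset.setC0.
  by rewrite ltnS leqn0 cards_eq0; apply/implyP => /eqP ->; rewrite finset.setC0.
by rewrite eqn_leq V0 andbT.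
Qed.

Section Plane.
Variable R : realType.
Implicit Types (x y z : 'rV[R]_2) (P : {fset 'rV[R]_2}).

Definition collinear x y z : Prop :=
  exists p d : 'rV[R]_2, d != 0 /\
    [set x; y; z] `<=` [set p + t *: d | t in [set: R]].

Definition general_position P : Prop :=
  forall x y z, x \in P -> y \in P -> z \in P ->
    x != y -> y != z -> x != z -> ~ collinear x y z.

Definition segment x y : set 'rV[R]_2 :=
  [set (1 - t) *: x + t *: y | t in `[0, 1]].

(* The vertices are the segments themselves, as subsets of the plane; an
   unordered pair {x, y} occurs once since segment x y = segment y x. *)
Definition segments P : {fset set 'rV[R]_2} :=
  [fset segment x y | x in P, y in P & x != y]%fset.

Definition disjointness_graph P : rel (segments P) :=
  [rel s t | [disjoint (val s) & (val t)]%classic].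

Lemma disjointness_graph_sym P : symmetric (disjointness_graph (P := P)).
Proof. by move=> s t; rewrite /disjointness_graph /= disj_set_sym. Qed.

Lemma segment_sym x y : segment x y = segment y x.
Proof.
suff sub a b : segment a b `<=` segment b a by apply/seteqP; split.
move=> _ [t + <-]; rewrite /= in_itv /= => /andP[t0 t1].
exists (1 - t); last by rewrite subKr addrC.
by rewrite /= in_itv /= subr_ge0 t1 gerBl t0.
Qed.

Lemma segmentsP P (s : set 'rV[R]_2) :
  reflect (exists x y, [/\ x \in P, y \in P, x != y & s = segment x y])
          (s \in segments P).
Proof.
apply: (iffP (imfset2P _ _ _ _ _)) => /= [[x xP [y]] | [x [y [xP yP xy ->]]]].
  by rewrite !inE => /andP[yP xy] ->; exists x, y.
by exists x => //; exists y => //; rewrite !inE yP xy.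
Qed.

Lemma disjointness_graph_irr P : irreflexive (disjointness_graph (P := P)).
Proof.
move=> s; apply/negbTE/disj_set2P; rewrite setIid.
have /segmentsP[x [y [_ _ _ ->]]] := valP s => s0.
suff: segment x y x by rewrite s0.
by exists 0; rewrite /= ?in_itv /= ?lexx ?ler01 // subr0 scale1r scale0r addr0.
Qed.

End Plane.

(* Main.v *)
Require Import Defs.
From mathcomp Require Import all_boot all_order all_algebra finmap.
From mathcomp Require Import boolp classical_sets set_interval reals.
From mathcomp Require Import zify ring lra.

Set Implicit Arguments.
Unset Strict Implicit.
Unset Printing Implicit Defensive.

Import Order.TTheory GRing.Theory Num.Theory.

(* Let k(n) be the bound and W a set of fewer than k(n) segments. The line through
   a segment leaves a and b points on its sides, a + b = n - 2, so every segment has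
   at least C(a,2) + C(b,2) >= k(n) neighbours, one of them outside W. If some point
   p lies on at least floor((n-3)/2) = k(n) - k(n-1) segments of W, delete p and
   induct: the neighbours of a segment at p avoid p. Otherwise every set of at least
   floor((n-1)/2) points spans a segment outside W. Call T a top set if it consists
   of the ceil(n/2) highest points in some direction. Segments inside T are disjoint
   from those inside P \ T, so all segments inside T outside W lie in one component
   of D(P) \ W. Rotating the direction changes T one point at a time, and
   consecutive top sets share a segment, so one component serves all top sets.
   Finally every segment is disjoint from some segment inside a top set for a normal
   direction of its line. *)

(** * Arithmetic of the bound k(n), coded as [halves2 n] *)

Definition halves2 (n : nat) : nat := 'C((n - 2)./2, 2) + 'C(uphalf (n - 2), 2).

(** One more point replaces a half of size [n./2] by one of size [n./2 + 1] and leaves the other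
    half unchanged. *)
Lemma halves2S (n : nat) : halves2 n.+3 = halves2 n.+2 + n./2.
Proof. by rewrite /halves2 !subSS !subn0 /= binS bin1; lia. Qed.

Lemma halves2_small (n : nat) : n < 3 -> halves2 n = 0.
Proof. by case: n => [|[|[|]]]. Qed.

Lemma double_bin2 (n : nat) : 'C(n, 2) * 2 + n = n * n.
Proof. by elim: n => // n IH; rewrite binS bin1; lia. Qed.

(** By convexity the balanced split is the smallest. With [j = i + o + 2e] the balanced parts are
    [i + e] and [i + o + e], and the two sides differ by [e(e + o)]. *)
Lemma halves2_le (i j : nat) : halves2 (i + j).+2 <= 'C(i, 2) + 'C(j, 2).
Proof.
wlog ij : i j / i <= j.
  move=> H; case/orP: (leq_total i j) => [|/H]; first exact: H.
  by rewrite addnC [X in _ <= X]addnC.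
have [d ->] : exists d, j = i + d by exists (j - i); rewrite subnKC.
have [e [o ->]] : exists e (o : bool), d = o + (e + e).
  by exists d./2, (odd d); rewrite addnn odd_double_half.
have -> : halves2 (i + (i + (o + (e + e)))).+2 = 'C(i + e, 2) + 'C(i + (o + e), 2).
  rewrite /halves2 !subSS subn0; congr ('C(_, 2) + 'C(_, 2)); case: o; lia.
have := double_bin2 (i + e); have := double_bin2 (i + (o + e)).
have := double_bin2 i; have := double_bin2 (i + (o + (e + e))).
by case: o; rewrite /= ?add0n ?add1n; nia.
Qed.

Lemma halves2_lt_bin (n : nat) : 2 < n -> halves2 n < 'C(n, 2).
Proof.
case: n => [|[|n]] // n0; have := halves2_le n 0.
rewrite addn0 [X in X <= _ -> _]/halves2 /= !binS !bin1 bin0n /= => H.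
by rewrite /halves2; lia.
Qed.

(** * Pairs of points separated by a direction *)

Section SeparatedPairs.
Import fintype boot.finset.
Variables (R : realFieldType) (V : finType) (pos : V -> R * R).
Implicit Types (S T E F X : {set V}) (W : {set {set V}}) (x y z p q : V).
Implicit Types (u v w : R * R) (C : {set V} -> Prop).

Local Open Scope ring_scope.

Definition dot u v : R := u.1 * v.1 + u.2 * v.2.

Definition height u x : R := dot u (pos x).

(** General position in terms of heights: [u] is a normal of the supposed line through three
    points. *)
Definition level_at_most_two : Prop := forall u x y z, 0 < dot u u ->
  x != y -> y != z -> x != z -> height u x = height u y ->
  height u y = height u z -> False.

(* Equal heights are allowed because a rotating direction meets level pairs; in
   general position this still makes the segments disjoint. *)
Definition weakly_separated E F : Prop := [disjoint E & F] /\
  exists2 u, 0 < dot u u & {in E & F, forall x y, height u y <= height u x}.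

(** A vertex of D(P) that survives the deletion of [W], coded by its two endpoints. *)
Definition edge S W E : bool := [&& #|E| == 2, E \subset S & E \notin W].

(** Connectivity is phrased without paths, through properties closed under adjacency; in the end [C]
    is reachability from a fixed segment. *)
Definition saturated S W C : Prop := forall E F,
  edge S W E -> edge S W F -> weakly_separated E F -> C E -> C F.

Definition edges_connected S W : Prop := forall C, saturated S W C ->
  forall E F, edge S W E -> edge S W F -> C E -> C F.

(** Ties at the boundary are allowed, so one direction may have several top sets of the same
    size. *)
Definition top_set S u T : Prop :=
  T \subset S /\ {in T & S :\: T, forall x y, height u y <= height u x}.

Lemma dot_gt0 u : (0 < dot u u) = (u != (0, 0)).
Proof.
case: u => a b; rewrite /dot /= xpair_eqE negb_and -!expr2 lt0r.
by rewrite addr_ge0 ?sqr_ge0 // andbT paddr_eq0 ?sqr_ge0 // !sqrf_eq0 negb_and.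
Qed.

Lemma dotN u v : dot (- u.1, - u.2) v = - dot u v.
Proof. by rewrite /dot /=; ring. Qed.

Lemma dotC u v : dot u v = dot v u.
Proof. by rewrite /dot /=; ring. Qed.

Lemma dot_comb (a b : R) u v w :
  dot (a * u.1 + b * v.1, a * u.2 + b * v.2) w = a * dot u w + b * dot v w.
Proof. by rewrite /dot /=; ring. Qed.

Lemma heightN u x : height (- u.1, - u.2) x = - height u x.
Proof. exact: dotN. Qed.

Lemma weakly_separated_sym E F : weakly_separated E F -> weakly_separated F E.
Proof.
move=> [dEF [u u0 H]]; split; first by rewrite disjoint_sym.
exists (- u.1, - u.2); first by rewrite dotN dotC dotN opprK.
by move=> x y xF yE; rewrite !heightN lerN2; apply: H.
Qed.

Lemma top_set_separated S u T E F : 0 < dot u u -> top_set S u T ->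
  E \subset T -> F \subset S :\: T -> weakly_separated E F.
Proof.
move=> u0 [TS H] ET FT; split.
  rewrite -setI_eq0; apply/eqP/setP => x; rewrite !inE; apply/andP => -[xE xF].
  by have := subsetP FT _ xF; rewrite inE (subsetP ET _ xE).
by exists u => // x y xE yF; apply: H; [apply: (subsetP ET)|apply: (subsetP FT)].
Qed.

Lemma top_set_exists S u (m : nat) : (m <= #|S|)%N ->
  exists2 T, top_set S u T & #|T| = m.
Proof.
elim: m => [_|m IH mS].
  exists set0; rewrite ?cards0 //; split; first by apply/subsetP => z; rewrite inE.
  by move=> x y; rewrite inE.
have [T [TS H] Tm] := IH (ltnW mS).
have /card_gt0P[q0 q0T] : (0 < #|S :\: T|)%N.
  by rewrite cardsDS // Tm subn_gt0.
case: (@Order.TotalTheory.arg_maxP _ _ _ q0 (mem (S :\: T)) (height u) q0T) => q qT qmax.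
have {}qT : q \in S :\: T by [].
have [qS qnT] : q \in S /\ q \notin T by move: qT; rewrite !inE => /andP[].
exists (q |: T); last by rewrite cardsU1 qnT Tm.
split; first by rewrite subUset sub1set qS.
move=> x y; rewrite !inE negb_or => xT /andP[/andP[yq yT] yS].
have yST : y \in S :\: T by rewrite inE yT.
by case/orP: xT => [/eqP ->|xT]; [apply: qmax|apply: H].
Qed.

Hypothesis two : level_at_most_two.
Hypothesis pos_inj : injective pos.

(** [u] is a normal of the line through the two points; general position keeps every third point off
    this line. *)
Lemma pair_level E : #|E| = 2 -> exists u (c : R), 0 < dot u u /\
  forall z, (height u z == c) = (z \in E).
Proof.
move/eqP/cards2P => [x [y [xy ->]]].
pose u : R * R := ((pos y).2 - (pos x).2, (pos x).1 - (pos y).1).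
have u0 : 0 < dot u u.
  rewrite dot_gt0 xpair_eqE !subr_eq0; apply: contraNN xy => /andP[/eqP h1 /eqP h2].
  by apply/eqP/pos_inj; rewrite [LHS]surjective_pairing [RHS]surjective_pairing h1 h2.
have uxy : height u x = height u y by rewrite /height /dot /=; ring.
exists u, (height u x); split=> // z; rewrite !inE; apply/eqP/orP.
  move=> zx; case: (eqVneq z x) => [|nzx]; first by left.
  case: (eqVneq z y) => [|nzy]; first by right.
  by case: (two u0 nzx xy nzy).
by case=> /eqP ->.
Qed.

(** The line through [E] splits the other points into [A] and [B]. Pairs inside one side are
    separated from [E], and by [halves2_le] they are too many to lie all in [W]. *)
Lemma separated_edge S W E : E \subset S -> #|E| = 2 ->
  (#|[set F in W | F \subset S]| < halves2 #|S|)%N ->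
  exists2 F, edge S W F & weakly_separated E F.
Proof.
move=> ES E2 Wk; have [u [c [u0 uc]]] := pair_level E2.
pose A := [set z in S | c < height u z]; pose B := [set z in S | height u z < c].
pose pairs X := [set F : {set V} | F \subset X & #|F| == 2].
have dAB X : X \subset A -> X \subset B -> X = set0.
  move=> XA XB; apply/setP => z; rewrite inE; apply/negP => zX.
  have := subsetP XA _ zX; have := subsetP XB _ zX; rewrite !inE.
  by move=> /andP[_ h] /andP[_]; rewrite ltNge ltW.
have SE : S :\: E = A :|: B.
  apply/setP => z; rewrite !inE -uc neq_lt; case: (z \in S); rewrite ?andbF //=.
  by rewrite andbT orbC.
have AB0 : A :&: B = set0 by apply: dAB; rewrite ?subsetIl ?subsetIr.
have SAB : #|S| = (#|A| + #|B|).+2.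
  have := cardsDS ES; rewrite SE cardsU AB0 cards0 E2 subn0 => ->.
  by have := subset_leq_card ES; rewrite E2; lia.
have pAB0 : pairs A :&: pairs B = set0.
  apply/setP => F; rewrite !inE; apply/negP => /andP[/andP[FA F2] /andP[FB _]].
  by move: F2; rewrite (dAB F) ?cards0.
have card_pairs : (halves2 #|S| <= #|pairs A :|: pairs B|)%N.
  by rewrite cardsU pAB0 cards0 subn0 !cards_draws SAB halves2_le.
have /subsetPn[F FAB FW] : ~~ (pairs A :|: pairs B \subset [set F in W | F \subset S]).
  by apply/negP => /subset_leq_card /(leq_trans card_pairs); rewrite leqNgt Wk.
have side X : X \subset S :\: E -> F \subset X -> #|F| == 2 ->
    edge S W F /\ [disjoint E & F].
  move=> XSE FX F2; have FSE := subset_trans FX XSE.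
  have FS : F \subset S := subset_trans FSE (subsetDl _ _).
  split; first by move: FW; rewrite /edge F2 FS inE FS andbT.
  by move: FSE; rewrite subsetD disjoint_sym => /andP[].
have Elevel x : x \in E -> height u x = c by rewrite -uc => /eqP.
move: FAB; rewrite !inE => /orP[] /andP[FX F2].
- have [|Fe EF] := side A _ FX F2; first by rewrite SE subsetUl.
  exists F => //; apply: weakly_separated_sym; split; first by rewrite disjoint_sym.
  exists u => // x y xF /Elevel ->; have := subsetP FX _ xF.
  by rewrite inE => /andP[_ /ltW].
- have [|Fe EF] := side B _ FX F2; first by rewrite SE subsetUr.
  exists F => //; split=> //.
  exists u => // x y /Elevel -> yF; have := subsetP FX _ yF.
  by rewrite inE => /andP[_ /ltW].
Qed.

(** If all pairs inside [X] were in [W], those joining one point of [X] to the rest would be at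
    least [(#|S| - 1)./2 - 1] members of [W] at that point. *)
Lemma sparse_edge S W X : (2 < #|S|)%N ->
  {in S, forall p, (#|[set F in W | (F \subset S) && (p \in F)]| < (#|S| - 3)./2)%N} ->
  X \subset S -> ((#|S| - 1)./2 <= #|X|)%N ->
  exists2 F, edge S W F & F \subset X.
Proof.
move=> S3 sparse XS Xh; apply: contrapT => noF.
have /card_gt0P[p pX] : (0 < #|X|)%N by lia.
have := sparse p (subsetP XS _ pX); rewrite ltnNge => /negP; apply.
have -> : ((#|S| - 3)./2 = (#|S| - 1)./2 - 1)%N by lia.
have Xp := cardsD1 p X; rewrite pX in Xp.
have star_inj : {in X :\ p &, injective (fun q => [set p; q])}.
  move=> q q'; rewrite !inE => /andP[qp _] _ /setP/(_ q).
  by rewrite !inE eqxx orbT (negPf qp) => /esym/eqP.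
apply: (@leq_trans #|[set [set p; q] | q in X :\ p]|).
  by rewrite (card_in_imset star_inj); lia.
apply: subset_leq_card; apply/subsetP => _ /imsetP[q + ->].
rewrite !inE => /andP[qp qX].
have pqX : [set p; q] \subset X by rewrite subUset !sub1set pX.
have pqS := subset_trans pqX XS.
rewrite pqS eqxx !andbT /=; apply: contrapT => /negP pqW.
by apply: noF; exists [set p; q] => //; rewrite /edge cards2 (eq_sym p) qp pqS.
Qed.

(** * Transport of a component between top sets *)

Section Sparse.
Variables (S : {set V}) (W : {set {set V}}) (C : {set V} -> Prop).
Hypothesis satC : saturated S W C.
Hypothesis dense : forall X, X \subset S -> ((#|S| - 1)./2 <= #|X|)%N ->
  exists2 F, edge S W F & F \subset X.

Let full T : Prop := forall F, edge S W F -> F \subset T -> C F.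

(** The complement of [T] is large enough to contain a surviving pair, and this pair is a common
    neighbour of all surviving pairs inside [T]. *)
Lemma top_set_full u T E : 0 < dot u u -> top_set S u T -> #|T| = uphalf #|S| ->
  edge S W E -> E \subset T -> C E -> full T.
Proof.
move=> u0 topT Th Ee ET CE F Fe FT.
have [|H He HT] := dense (subsetDl S T).
  by rewrite cardsDS ?Th; [lia|case: topT].
have EH := top_set_separated u0 topT ET HT; have FH := top_set_separated u0 topT FT HT.
exact: satC He Fe (weakly_separated_sym FH) (satC Ee He EH CE).
Qed.

Lemma exchange_full u T T' : 0 < dot u u -> top_set S u T' ->
  #|T'| = uphalf #|S| -> T \subset S -> ((#|S| - 1)./2 <= #|T :&: T'|)%N ->
  full T -> full T'.
Proof.
move=> u0 topT' T'h TS I fT.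
have [|F Fe FI] := dense _ I; first by apply: subset_trans TS; apply: subsetIl.
move: FI; rewrite subsetI => /andP[FT FT'].
exact: top_set_full u0 topT' T'h Fe FT' (fT _ Fe FT).
Qed.

(** Points of [T :\: T'] and of [T' :\: T] all have the same height, so general position leaves at
    most one in each. The intersection is then just large enough:
    [uphalf #|S| - 1 = (#|S| - 1)./2]. *)
Lemma same_direction_full u T T' : 0 < dot u u -> top_set S u T -> top_set S u T' ->
  #|T| = uphalf #|S| -> #|T'| = uphalf #|S| -> full T -> full T'.
Proof.
move=> u0 topT topT' Th T'h fT; have [TS HT] := topT; have [T'S HT'] := topT'.
apply: (exchange_full u0 topT' T'h TS _ fT).
have := cardsID T' T; have := cardsID T T'; rewrite setIC.
suff : (#|T :\: T'| <= 1)%N by lia.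
rewrite leqNgt; apply/negP => /card_gt1P[x [y [xT yT xy]]].
have /card_gt0P[z zT] : (0 < #|T' :\: T|)%N.
  have := cardsID T' T; have := cardsID T T'; rewrite setIC.
  have : (0 < #|T :\: T'|)%N by apply/card_gt0P; exists x.
  by lia.
have level p : p \in T :\: T' -> p != z /\ height u p = height u z.
  move: zT; rewrite !inE => /andP[znT zT'] /andP[pnT' pT]; split.
    by apply: contraNneq znT => <-.
  have pST' : p \in S :\: T' by rewrite inE pnT' (subsetP TS).
  have zST : z \in S :\: T by rewrite inE znT (subsetP T'S).
  by apply/eqP; rewrite eq_le HT' ?HT.
have [xz hx] := level x xT; have [yz hy] := level y yT.
by apply: (two u0 xy yz xz); rewrite ?hx ?hy.
Qed.

(* Turning u towards u', the first pair p \in T, q \notin T to become level is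
   the one with the least ratio of its height gap in u to its reversed gap in u';
   exchanging p and q raises the ranks of T in direction u'. *)
Lemma rotate_full u u' T T' : 0 < dot u u -> 0 < dot u' u' -> 0 <= dot u u' ->
  top_set S u T -> top_set S u' T' -> #|T| = uphalf #|S| -> #|T'| = uphalf #|S| ->
  full T -> full T'.
Proof.
move=> + u'0 + + topT' + T'h.
pose above p := #|[set r | height u' p < height u' r]|.
have [m] := ubnP (\sum_(p in T) above p)%N.
elim: m => // m IH in u T *; rewrite ltnS => Tm u0 uu' topT Th fT.
have [TS HT] := topT.
pose bad := [pred pq : V * V | [&& pq.1 \in T, pq.2 \in S :\: T &
                                height u' pq.1 < height u' pq.2]].
have [pq0 bad0|nobad] := pickP bad; last first.
  apply: (same_direction_full u'0 _ topT' Th T'h fT); split=> // x y xT yT.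
  by have := nobad (x, y); rewrite /= xT yT /= => /negbT; rewrite -leNgt.
pose ratio (pq : V * V) := (height u pq.1 - height u pq.2) /
                           (height u' pq.2 - height u' pq.1).
case: (@Order.TotalTheory.arg_minP _ _ _ pq0 bad ratio bad0) => -[p q] /and3P[/= pT qT hpq] rmin.
have {}qT : q \in S :\: T by [].
pose al := height u p - height u q; pose be := height u' q - height u' p.
have al0 : 0 <= al by rewrite subr_ge0 HT.
have be0 : 0 < be by rewrite subr_gt0.
(* In direction [w], between [u] and [u'], the points [p] and [q] are level. If they already are in
   direction [u], then [al = 0] and [w] is a multiple of [u]. *)
pose w : R * R := (be * u.1 + al * u'.1, be * u.2 + al * u'.2).
have hw x : height w x = be * height u x + al * height u' x by apply: dot_comb.
have wu' : dot w u' = be * dot u u' + al * dot u' u' by apply: dot_comb.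
(* As [be > 0], the hypothesis [0 <= dot u u'] keeps this combination from vanishing. *)
have w0 : 0 < dot w w.
  rewrite lt_def; apply/andP; split; last by rewrite /dot -!expr2 addr_ge0 ?sqr_ge0.
  rewrite dot_comb [dot u w]dotC [dot u' w]dotC.
  have -> : dot w u = be * dot u u + al * dot u u'.
    by rewrite dot_comb [dot u' u]dotC.
  rewrite wu'; apply/lt0r_neq0/ltr_wpDr.
    by rewrite mulr_ge0 // addr_ge0 // mulr_ge0 // ltW.
  by apply: mulr_gt0 be0 (ltr_wpDr (mulr_ge0 al0 uu') (mulr_gt0 be0 u0)).
have wu'0 : 0 <= dot w u'.
  by rewrite wu'; apply: addr_ge0; apply: mulr_ge0 => //; apply: ltW.
have hwpq : height w p = height w q by rewrite !hw /al /be; ring.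
have topw : top_set S w T.
  split=> // x y xT yT; rewrite !hw.
  have hxy : 0 <= height u x - height u y by rewrite subr_ge0 HT.
  have [le'|lt'] := leP (height u' y) (height u' x).
    by apply: lerD; apply: ler_wpM2l => //; [apply: ltW|apply: HT].
  (* A bad pair is not yet inverted in direction [w], since its ratio is at least [al / be]. *)
  have /rmin : bad (x, y) by rewrite /= xT yT.
  rewrite /ratio /= -/al -/be ler_pdivrMr // mulrAC ler_pdivlMr ?subr_gt0 //.
  rewrite -subr_ge0 => le; rewrite -subr_ge0; apply: le_trans le _.
  by rewrite le_eqVlt; apply/orP; left; apply/eqP; ring.
have [qS qnT] : q \in S /\ q \notin T by move: qT; rewrite inE => /andP[].
pose T1 := q |: (T :\ p).
have topT1 : top_set S w T1.
  case: topw => _ Hw; split.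
    by rewrite subUset sub1set qS (subset_trans (subsetDl _ _) TS).
  have above_p x : x \in T1 -> height w p <= height w x.
    rewrite hwpq; rewrite !inE => /orP[/eqP -> //|/andP[_ xT]]; exact: Hw.
  have below_p y : y \in S :\: T1 -> height w y <= height w p.
    rewrite !inE negb_or negb_and negbK => /andP[/andP[yq /orP[/eqP -> //|yT]] yS].
    by apply: Hw => //; rewrite inE yT.
  by move=> x y /above_p hx /below_p hy; apply: le_trans hx.
have qTp : q \notin T :\ p by rewrite inE negb_and qnT orbT.
have T1h : #|T1| = uphalf #|S|.
  by rewrite cardsU1 qTp -Th (cardsD1 p T) pT.
apply: (IH w T1) => //.
  apply: leq_trans Tm; rewrite (big_setD1 p pT) /= /T1 big_setU1 //= ltn_add2r.
  apply: proper_card; apply/properP; split.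
    by apply/subsetP => r; rewrite !inE; apply: lt_trans.
  by exists q; rewrite !inE ?ltxx.
apply: (exchange_full w0 topT1 T1h TS _ fT).
have /subset_leq_card : T :\ p \subset T :&: T1.
  by rewrite subsetI subsetDl subsetUr.
apply: leq_trans; have -> : #|T :\ p| = (uphalf #|S|).-1.
  by rewrite -Th (cardsD1 p T) pT.
by clear; lia.
Qed.

(** [rotate_full] turns through at most a right angle, so the turn is made in two stages, through a
    normal of [u] signed to lie on the side of [u']. *)
Lemma any_direction_full u u' T T' : 0 < dot u u -> 0 < dot u' u' ->
  top_set S u T -> top_set S u' T' -> #|T| = uphalf #|S| -> #|T'| = uphalf #|S| ->
  full T -> full T'.
Proof.
move=> u0 u'0 topT topT' Th T'h fT.
have [w [w0 uw wu']] : exists w, [/\ 0 < dot w w, 0 <= dot u w & 0 <= dot w u'].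
  pose w : R * R := (- u.2, u.1).
  have ww : dot w w = dot u u by rewrite /dot /=; ring.
  have uw : dot u w = 0 by rewrite /dot /=; ring.
  have [wu'|wu'] := leP 0 (dot w u'); first by exists w; rewrite ww uw.
  exists (- w.1, - w.2); rewrite !dotN [dot u _]dotC [dot w (_, _)]dotC !dotN.
  by rewrite [dot w u]dotC opprK ww uw oppr0 oppr_ge0 (ltW wu').
have [|Tw topw wh] := @top_set_exists S w (uphalf #|S|); first by lia.
exact: rotate_full wu' topw topT' wh T'h (rotate_full u0 w0 uw topT topw Th wh fT).
Qed.

(** Let [u] be normal to the line of [E] and point to a side [A] with at least [(#|S| - 1)./2]
    points. Then [A] and [T] are nested, both consisting of highest points, and the smaller one
    contains a surviving pair. *)
Lemma edge_sees_top_set E : edge S W E -> exists u T F,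
  [/\ 0 < dot u u, top_set S u T & #|T| = uphalf #|S|] /\
  [/\ edge S W F, F \subset T & weakly_separated E F].
Proof.
move=> /and3P[/eqP E2 ES _]; have [v [c [v0 vc]]] := pair_level E2.
have [u [d [u0 uc Ah]]] : exists u (d : R), [/\ 0 < dot u u,
    forall z, (height u z == d) = (z \in E) &
    ((#|S| - 1)./2 <= #|[set z in S | (d < height u z)%R]|)%N].
  pose A := [set z in S | (c < height v z)%R]; pose B := [set z in S | (height v z < c)%R].
  have AB : (#|S :\: E| <= #|A| + #|B|)%N.
    apply: leq_trans (leq_subr #|A :&: B| _); rewrite -cardsU; apply: subset_leq_card.
    apply/subsetP => z; rewrite !inE -vc neq_lt => /andP[/orP[] -> ->];
      by rewrite ?orbT.
  rewrite cardsDS // E2 in AB.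
  have [hA|hA] := leqP (#|S| - 1)./2 #|A|; first by exists v, c.
  exists (- v.1, - v.2), (- c); split.
  - by rewrite dotN dotC dotN opprK.
  - by move=> z; rewrite heightN eqr_opp vc.
  - suff -> : [set z in S | - c < height (- v.1, - v.2) z] = B by lia.
    by apply/setP => z; rewrite !inE heightN ltrN2.
set A := [set z in S | d < height u z] in Ah.
have [|T [TS HT] Th] := @top_set_exists S u (uphalf #|S|); first by lia.
have TAh : ((#|S| - 1)./2 <= #|T :&: A|)%N.
  have [AT|/subsetPn[z zA zT]] := boolP (A \subset T).
    by rewrite (setIidPr AT).
  suff /setIidPl -> : T \subset A by lia.
  apply/subsetP => x xT; move: zA; rewrite !inE => /andP[zS dz].
  by rewrite (subsetP TS) //=; apply: (lt_le_trans dz); apply: HT; rewrite // inE zT.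
have [|F Fe] := dense _ TAh; first by apply: subset_trans TS; apply: subsetIl.
rewrite subsetI => /andP[FT FA]; exists u, T, F; do 2!split=> //.
apply: weakly_separated_sym; split.
  rewrite -setI_eq0; apply/eqP/setP => x; rewrite !inE; apply/andP => -[xF].
  have := subsetP FA _ xF; rewrite inE => /andP[_ dx].
  by rewrite -uc => /eqP xd; rewrite xd ltxx in dx.
exists u => // x y xF; rewrite -uc => /eqP ->; have := subsetP FA _ xF.
by rewrite inE => /andP[_ /ltW].
Qed.

Lemma dense_saturated_full E F : edge S W E -> edge S W F -> C E -> C F.
Proof.
move=> Ee Fe CE.
have [u [T [G [[u0 topT Th] [Ge GT EG]]]]] := edge_sees_top_set Ee.
have [u' [T' [H [[u'0 topT' T'h] [He HT' FH]]]]] := edge_sees_top_set Fe.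
have fT : full T := top_set_full u0 topT Th Ge GT (satC Ee Ge EG CE).
have fT' := any_direction_full u0 u'0 topT topT' Th T'h fT.
exact: satC He Fe (weakly_separated_sym FH) (fT' _ He HT').
Qed.

End Sparse.

(** * Induction on the number of points *)

Lemma few_removed_connected S W :
  (#|[set F in W | F \subset S]| < halves2 #|S|)%N -> edges_connected S W.
Proof.
(* [W] stays fixed while [S] shrinks, so only the members of [W] inside [S] are counted. *)
have [m] := ubnP #|S|; elim: m => // m IH in S *; rewrite ltnS => Sm Wk C satC.
have S3 : (2 < #|S|)%N.
  by rewrite ltnNge; apply/negP => S2; rewrite halves2_small in Wk.
pose star p := [set F in W | (F \subset S) && (p \in F)].
have [/existsP[p /andP[pS dp]]|] :=
    boolP [exists p, (p \in S) && ((#|S| - 3)./2 <= #|star p|)%N]; last first.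
  rewrite negb_exists => /forallP sparse.
  apply: (dense_saturated_full satC) => X XS; apply: sparse_edge S3 _ XS => p pS.
  by have := sparse p; rewrite pS /= -ltnNge.
have Sp : #|S| = (#|S :\ p|).+1 by rewrite (cardsD1 p S) pS.
have edgeD E : edge (S :\ p) W E = edge S W E && (p \notin E).
  by rewrite /edge subsetD1; case: (_ == _); case: (_ \subset _);
    case: (_ \in W); case: (_ \in E).
have connD : edges_connected (S :\ p) W.
  apply: IH; first by lia.
  (* Deleting [p] lowers the count by at least [(#|S| - 3)./2], which is the drop of [halves2]. *)
  have Wsplit : #|[set F in W | F \subset S]| =
      (#|star p| + #|[set F in W | F \subset S :\ p]|)%N.
    rewrite -(cardsID [set F : {set V} | p \in F]); congr addn.
      by apply: eq_card => F; rewrite !inE andbA.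
    by apply: eq_card => F; rewrite !inE subsetD1 andbC -andbA.
  move: Wk dp Sm; rewrite Wsplit; case: #|S| Sp S3 => [|[|[|k]]] // -[<-] _.
  by rewrite halves2S !subSS subn0; lia.
have satD : saturated (S :\ p) W C.
  by move=> E F; rewrite !edgeD => /andP[Ee _] /andP[Fe _]; apply: satC.
(* A surviving pair at [p] has a surviving neighbour, which is disjoint from it and so avoids
   [p]. *)
have reach E : edge S W E -> exists2 E', edge (S :\ p) W E' & (C E <-> C E').
  move=> Ee; have [pE|pE] := boolP (p \in E); last by exists E; rewrite ?edgeD ?Ee.
  have /and3P[/eqP E2 ES _] := Ee.
  have [F Fe EF] := separated_edge ES E2 Wk; exists F.
    by rewrite edgeD Fe (disjointFr (proj1 EF) pE).
  by split; apply: satC => //; apply: weakly_separated_sym.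
move=> E F /reach[E' E'e EE'] /reach[F' F'e FF'] /EE' CE'.
by apply/FF'; apply: connD satD _ _ E'e F'e CE'.
Qed.

End SeparatedPairs.

(** * From pairs of points back to segments in the plane *)

Section GeneralPosition.
Variables (R : realType) (P : {fset 'rV[R]_2}%fset).
Hypothesis genP : general_position P.
Implicit Types (x y z w : P) (E F : {set P}) (s t : segments P).

Local Open Scope ring_scope.

Definition coords (p : 'rV[R]_2) : R * R := (p 0 0, p 0 1).

Let pos x := coords (val x).

Lemma coords_inj : injective coords.
Proof.
move=> p q [p0 p1]; apply/rowP => i.
by case: i => [[|[|//]] hi]; [have -> : Ordinal hi = 0|have -> : Ordinal hi = 1];
  rewrite //; apply: val_inj.
Qed.

Lemma dot_convex u (a : R) (p q : 'rV[R]_2) :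
  dot u (coords ((1 - a) *: p + a *: q)) =
  (1 - a) * dot u (coords p) + a * dot u (coords q).
Proof. by rewrite /dot /= !mxE; ring. Qed.

Lemma pos_level_at_most_two : level_at_most_two pos.
Proof.
move=> u x y z u0 xy yz xz hxy hyz.
apply: (genP (valP x) (valP y) (valP z)); rewrite ?(inj_eq val_inj) //.
pose d : 'rV[R]_2 := \row_i (if i == 0 then - u.2 else u.1).
exists (val x), d; split.
  apply: contraTneq u0 => /rowP d0; have := d0 0; have := d0 1; rewrite !mxE /=.
  by move=> u1 /eqP; rewrite oppr_eq0 => /eqP u2; rewrite /dot u1 u2 !mulr0 addr0 ltxx.
have online (q : P) : height pos u q = height pos u x ->
    exists2 a, True & val x + a *: d = val q.
  rewrite /height /= => hq; have D0 := lt0r_neq0 u0.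
  pose d1 := val q 0 0 - val x 0 0; pose d2 := val q 0 1 - val x 0 1.
  have h0 : u.1 * d1 + u.2 * d2 = 0.
    by apply/eqP; rewrite !mulrBr addrACA -opprD subr_eq0; apply/eqP.
  (* [k] is the inner product of [d] with [val q - val x], so [k / dot u u] is the parameter of [q]
     on the line through [x] with direction [d]. *)
  pose k := u.1 * d2 - u.2 * d1.
  have k1 : k * - u.2 = d1 * dot u u.
    apply/eqP; rewrite -subr_eq0 (_ : _ - _ = - u.1 * (u.1 * d1 + u.2 * d2)).
      by rewrite h0 mulr0.
    by rewrite /k /dot; ring.
  have k2 : k * u.1 = d2 * dot u u.
    apply/eqP; rewrite -subr_eq0 (_ : _ - _ = - u.2 * (u.1 * d1 + u.2 * d2)).
      by rewrite h0 mulr0.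
    by rewrite /k /dot; ring.
  exists (k / dot u u) => //; apply: coords_inj; rewrite /coords /= !mxE /=.
  by congr pair; rewrite mulrAC ?k1 ?k2 mulfK // addrC subrK.
move=> q [[->|->]|->].
- exact: online.
- by apply: online; rewrite hxy.
- by apply: online; rewrite hxy hyz.
Qed.

(* By general position a segment contains no points of P but its endpoints. *)
Definition ends s : {set P} := [set x | `[< val s (val x) >] ].

Lemma ends_segment s x y : val s = segment (val x) (val y) -> x != y ->
  ends s = [set x; y]%SET.
Proof.
move=> sxy nxy; apply/setP => z; rewrite !inE sxy; apply/asboolP/orP; last first.
  case=> /eqP ->; [exists 0|exists 1]; rewrite ?subr0 ?subrr ?scale1r ?scale0r ?addr0 ?add0r //=.
    by rewrite in_itv /= lexx ler01.
  by rewrite in_itv /= lexx ler01.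
case=> a _ az; case: (eqVneq z x) => [|zx]; first by left.
case: (eqVneq z y) => [|zy]; first by right.
case: (genP (valP x) (valP y) (valP z)); rewrite ?(inj_eq val_inj) // 1?eq_sym //.
exists (val x), (val y - val x); split; first by rewrite subr_eq0 (inj_eq val_inj) eq_sym.
move=> q [[->|->]|->].
- by exists 0 => //; rewrite scale0r addr0.
- by exists 1 => //; rewrite scale1r addrC subrK.
- by exists a => //; rewrite -az scalerBr scalerBl scale1r addrA addrAC.
Qed.

Lemma endsP s : exists x y,
  [/\ x != y, val s = segment (val x) (val y) & ends s = [set x; y]%SET].
Proof.
have /segmentsP[p [q [pP qP pq e]]] := valP s.
have xy : [` pP]%fset != [` qP]%fset by rewrite -(inj_eq val_inj).
by exists [` pP]%fset, [` qP]%fset; split=> //; apply: ends_segment.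
Qed.

Lemma card_ends s : #|ends s| = 2.
Proof. by have [x [y [xy _ ->]]] := endsP s; rewrite cards2 xy. Qed.

(** With [pair_ends], this identifies the vertices of D(P) with the two-element subsets of [P]. *)
Lemma ends_inj : injective ends.
Proof.
move=> s t; have [x [y [xy sxy ->]]] := endsP s; have [z [w [zw tzw ->]]] := endsP t.
move=> /setP E; apply: val_inj; rewrite sxy tzw.
have := E x; have := E y; rewrite !inE !eqxx /= orbT.
move=> /esym/orP[] /eqP ey /esym/orP[] /eqP ex; move: xy; rewrite ex ey ?eqxx // => _.
exact: segment_sym.
Qed.

Lemma pair_ends E : #|E| = 2 -> exists s, ends s = E.
Proof.
move/eqP/cards2P => [x [y [xy ->]]].
have sP : segment (val x) (val y) \in segments P.
  apply/segmentsP; exists (val x), (val y).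
  by split; [exact: valP|exact: valP|rewrite (inj_eq val_inj)|].
by exists [` sP]%fset; apply: ends_segment.
Qed.

(** A common point is at least as high as the lower end [x] of one segment and at most as high as
    the upper end [z] of the other, so all three are level. As three points of [P] are never level,
    the common point is both [x] and [z], which are distinct. *)
Lemma separated_disjoint s t :
  weakly_separated pos (ends s) (ends t) -> disjointness_graph s t.
Proof.
have main (u : R * R) x y z w : 0 < dot u u -> x != y -> z != w ->
    x != z -> x != w -> y != z -> height pos u z <= height pos u x ->
    height pos u x <= height pos u y -> height pos u w <= height pos u z ->
    [disjoint segment (val x) (val y) & segment (val z) (val w)]%classic.
  move=> u0 xy zw xz xw yz zx xy' wz; apply/disj_setPS => p [[a + pa] [b + pb]].
  rewrite /= !in_itv /= => /andP[a0 a1] /andP[b0 b1].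
  have : (1 - a) * height pos u x + a * height pos u y =
         (1 - b) * height pos u z + b * height pos u w.
    by rewrite -!dot_convex pa pb.
  set hx := height pos u x in zx xy' *; set hy := height pos u y in xy' *.
  set hz := height pos u z in zx wz *; set hw := height pos u w in wz *.
  move=> e.
  have ea : 0 <= a * (hy - hx) by rewrite mulr_ge0 ?subr_ge0.
  have eb : 0 <= b * (hz - hw) by rewrite mulr_ge0 ?subr_ge0.
  have hxz : hx = hz by lra.
  have {}ea : a * (hy - hx) == 0 by apply/eqP; lra.
  have {}eb : b * (hz - hw) == 0 by apply/eqP; lra.
  move: ea eb; rewrite !mulf_eq0 !subr_eq0 => /orP[/eqP a_0|/eqP yx]; last first.
    by case: (pos_level_at_most_two u0 (_ : y != x) xz yz); rewrite // eq_sym.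
  case/orP => [/eqP b_0|/eqP zw']; last first.
    by case: (pos_level_at_most_two u0 xz zw xw).
  move: pa; rewrite -pb a_0 b_0 subr0 !scale0r !addr0 !scale1r => /val_inj/eqP.
  by rewrite (negPf xz).
have [x [y [xy sxy ->]]] := endsP s; have [z [w [zw tzw ->]]] := endsP t.
case=> dis [u u0 H]; rewrite /disjointness_graph /= sxy tzw.
have neq p q : p \in [set x; y]%SET -> q \in [set z; w]%SET -> p != q.
  by move=> px qz; apply: contraTneq px => ->; rewrite (disjointFl dis).
have [x2 y2] : x \in [set x; y]%SET /\ y \in [set x; y]%SET by rewrite !inE !eqxx orbT.
have [z2 w2] : z \in [set z; w]%SET /\ w \in [set z; w]%SET by rewrite !inE !eqxx orbT.
clear sxy tzw; wlog hxy : x y xy dis H neq x2 y2 / height pos u x <= height pos u y.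
  move=> W; case: (leP (height pos u x) (height pos u y)) => [|/ltW]; first exact: W.
  by rewrite [segment (val x) _]segment_sym; apply: W; rewrite // 1?eq_sym // (finset.setUC [set y]%SET).
wlog hwz : z w zw dis H neq z2 w2 / height pos u w <= height pos u z.
  move=> W; case: (leP (height pos u w) (height pos u z)) => [|/ltW]; first exact: W.
  by rewrite [segment (val z) _]segment_sym; apply: W; rewrite // 1?eq_sym // (finset.setUC [set w]%SET).
by apply: main u0 xy zw _ _ _ _ hxy hwz; rewrite ?neq ?H.
Qed.

End GeneralPosition.

Theorem theorem1 (R : realType) (n : nat) (P : {fset 'rV[R]_2}%fset)
    (hn : 3 <= n) (cardP : #|` P|%fset = n) (genP : general_position P) :
  'C((n - 2)./2, 2) + 'C(uphalf (n - 2), 2)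
    <= connectivity (@disjointness_graph R P).
Proof.
have cardV : #|[set: P]%SET| = n by rewrite cardsT -cardP cardfE.
(* This serves the requirement of more than k(n) vertices. *)
have bin_le : 'C(n, 2) <= #|[set: segments P]%SET|.
  rewrite -cardV -cards_draws.
  apply: leq_trans (leq_imset_card (@ends R P) [set: segments P]%SET).
  apply: subset_leq_card; apply/fintype.subsetP => E.
  rewrite inE => /andP[_ /eqP /(pair_ends genP)[s <-]]; exact: imset_f.
have := leq_trans (halves2_lt_bin hn) bin_le; rewrite cardsT => lt_card.
rewrite -[X in X <= _]/(halves2 n) -connectivityP; last exact: leq_trans lt_card.
apply/andP; split=> //; apply/forallP => W; apply/implyP => Wn.
pose D := [set ends s | s in W]%SET.
have edge_ends s : s \notin W -> edge [set: P]%SET D (ends s).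
  move=> sW; rewrite /edge (card_ends genP) finset.subsetT /=.
  by apply: contra sW => /imsetP[t tW /(ends_inj genP) ->].
have few : #|[set F in D | F \subset [set: P]%SET]%SET| < halves2 #|[set: P]%SET|.
  rewrite cardV; apply: leq_ltn_trans Wn.
  apply: leq_trans (leq_imset_card (@ends R P) W); apply: subset_leq_card.
  by apply/fintype.subsetP => F; rewrite inE => /andP[].
have pos_inj : injective (fun x : P => coords (val x)).
  by move=> x y /coords_inj/val_inj.
apply/forallP => s; apply/implyP; rewrite inE => sW.
apply/forallP => t; apply/implyP; rewrite inE => tW.
pose r := [rel u v in (~: W)%SET | disjointness_graph u v].
(* Reachability from [s] outside [W], read on endpoint pairs; by [ends_inj] at most one [v] is
   concerned. *)
pose C E := forall v, ends v = E -> connect r s v.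
apply: (few_removed_connected (pos_level_at_most_two genP) pos_inj few (C := C)
  _ (edge_ends s sW) (edge_ends t tW)) => //; last by move=> v /(ends_inj genP) ->.
move=> E F /and3P[/eqP /(pair_ends genP)[v <-] _ vD] /and3P[_ _ FD] sep Cv w wF.
have notW x : ends x \notin D -> x \in (~: W)%SET.
  by rewrite inE; apply: contra; apply: imset_f.
apply: connect_trans (Cv v erefl) (connect1 _) => /=.
by rewrite !notW ?wF //=; apply: separated_disjoint => //; rewrite wF.
Qed.
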